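(* Let $\mathcal{M}$ be a Minsky machine satisfying the standing assumptions below. If $m\ge3$ and $R\le\mathbb{A}(\mathcal{M})^m$ fails to be computational or is halting, then $\mathrm{Rel}_{\le m-1}(\mathbb{A}(\mathcal{M}))\models R$, i.e. every finitary operation on $A(\mathcal{M})$ that preserves all relations of $\mathbb{A}(\mathcal{M})$ of arity at most $m-1$ also preserves $R$.
   Context: Minsky machines. A Minsky machine $\mathcal{M}$ has states $\{0,1,\dots,N\}$ ($0$ is the halting state, $1$ the initial state), two registers $A,B$ holding values in $\mathbb{N}$, and a finite set of instructions of the forms $(i,R,j)$ and $(i,R,k,j)$ with $R\in\{A,B\}$. It acts on configurations $(s,\alpha,\beta)\in\{0,\dots,N\}\times\mathbb{N}\times\mathbb{N}$: $\mathcal{M}(i,\alpha,\beta)$ is $(j,\alpha+1,\beta)$ if $(i,A,j)\in\mathcal{M}$; $(j,\alpha,\beta+1)$ if $(i,B,j)\in\mathcal{M}$; $(j,\alpha-1,\beta)$ if $(i,A,k,j)\in\mathcal{M}$ and $\alpha\neq0$; $(j,\alpha,\beta-1)$ if $(i,B,k,j)\in\mathcal{M}$ and $\beta\ne 0$; $(k,\alpha,\beta)$ if $(i,A,k,j)\in\mathcal{M}$ and $\alpha=0$, or $(i,B,k,j)\in\mathcal{M}$ and $\beta=0$; and $(0,\alpha,\beta)$ if $i=0$. $\mathcal{M}$ halts if $\mathcal{M}^n(1,0,0)$ has state $0$ for some $n$. Standing assumptions on $\mathcal{M}$: it returns both registers to $0$ before halting; it has exactly one instruction $(i,\dots)$ for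 each non-halting state $i$; the instruction for state $1$ has the form $(1,R,s)$; in the state graph (vertices the states, an edge $i\to j$ iff $\mathcal{M}(i,\alpha,\beta)=(j,\alpha',\beta')$ for some $\alpha,\beta,\alpha',\beta'$) every state is reachable from $1$ and $0$ is reachable from every state; and $\mathcal{M}$ halts with capacity $\kappa$ (i.e. it halts and $\alpha+\beta\le\kappa$ whenever $\mathcal{M}^n(1,0,0)=(i,\alpha,\beta)$). The algebra. $A(\mathcal{M})=\{\langle i,c\rangle: 0\le i\le N,\ c\in\{\bullet,\times,0,A,B\}\}$. Put $X=\{\langle i,\times\rangle\}$, $D=\{\langle i,\bullet\rangle\}$, $C=A(\mathcal{M})\setminus(X\cup D)$; $\mathrm{X}(\langle i,c\rangle)=\langle i,\times\rangle$, $\mathrm{State}(\langle i,c\rangle)=i$, $\mathrm{Content}(\langle i,c\rangle)=c$. Write ''$(i,R,\dots,j)\in\mathcal{M}$'' to mean $(i,R,j)\in\mathcal{M}$ or $(i,R,k,j)\in\mathcal{M}$ for some $k$. The operations (cases read in order, first applicable case applies): $\langle i,c\rangle\wedge\langle j,d\rangle$ is $\langle i,c\rangle$ if the two are equal, else $\langle\min(i,j),\times\rangle$. $M(x,y)$: $\langle j,R\rangle$ if $x=\langle i,\bullet\rangle, y=\langle i,0\rangle,(i,R,j)\in\mathcal{M}$; $\langle j,0\rangle$ if $x=\langle i,\bullet\rangle,y=\langle i,R\rangle,(i,R,k,j)\in\mathcal{M}$; $\langle j,\bullet\rangle$ if $x=\langle i,0\rangle,y=\langle i,\bullet\rangle,(i,R,j)\in\mathcal{M}$;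 $\langle j,\bullet\rangle$ if $x=\langle i,R\rangle,y=\langle i,\bullet\rangle,(i,R,k,j)\in\mathcal{M}$; $\langle j,c\rangle$ if $x=y=\langle i,c\rangle$, $c\ne\bullet$, $(i,R,\dots,j)\in\mathcal{M}$; $\langle j,\times\rangle$ if $\mathrm{State}(x)=\mathrm{State}(y)=i$ and $(i,R,\dots,j)\in\mathcal{M}$; otherwise $\mathrm{X}(y)$. $M'(x)$: $\langle k,c\rangle$ if $x=\langle i,c\rangle$, $(i,R,k,j)\in\mathcal{M}$, $c\neq R$; $\langle k,\times\rangle$ if $\mathrm{State}(x)=i$ and $(i,R,k,j)\in\mathcal{M}$; otherwise $\mathrm{X}(x)$. $I(x,y)$: $\langle1,\bullet\rangle$ if $x\in D$; $\langle 1,0\rangle$ if $y\in C$; otherwise $\langle1,\times\rangle$. $H(x)$: $\langle0,0\rangle$ if $x\in\{\langle0,0\rangle,\langle0,\bullet\rangle\}$, otherwise $\langle0,\times\rangle$. $N_0(x,y,z)$: $y$ if $x=\langle0,\bullet\rangle$ and $\mathrm{State}(y)=\mathrm{State}(z)$; $z$ if $x=\langle0,0\rangle$, $z\notin D$, $\mathrm{State}(y)=\mathrm{State}(z)$; otherwise $\mathrm{X}(y\wedge z)$. $S(x,y,z)$: $\langle1,0\rangle$ if $x=\langle1,0\rangle$, $\mathrm{State}(y)=\mathrm{State}(z)=1$ and $(\mathrm{Content}(y),\mathrm{Content}(z))\in\{(\bullet,0),(0,\bullet),(0,0)\}$; otherwise $\langle1,\times\rangle$. $N_\bullet(u,x,y,z)$,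 where the first four cases require $\mathrm{State}(x)=\mathrm{State}(y)=\mathrm{State}(z)$: $x$ if $x=y\notin X$; $x$ if $u\in D$, $y\in X$; $y$ if $u\in D$, $x\in X$; $z$ if $u\in D$, $z\in\{x,y\}$; otherwise $\mathrm{X}(x\wedge y\wedge z)$. $P(u,v,x,y)$: $x$ if $\mathrm{State}(u)=\mathrm{State}(v)$, else $y$. $\mathbb{A}(\mathcal{M})=\langle A(\mathcal{M});\wedge,M,M',I,H,N_0,S,N_\bullet,P\rangle$; operations act coordinatewise on powers; $R\le\mathbb{A}(\mathcal{M})^m$ means $R$ is a (nonempty) subuniverse of $A(\mathcal{M})^m$ (a relation of arity $m$). Relation notions. $s\in A(\mathcal{M})^m$ is synchronized if $\mathrm{State}(s(i))$ is constant in $i$. $R$ is computational if all its elements are synchronized and each $r\in R$ has at most one coordinate in $D$. $R$ is halting if it contains some $r\in\{\langle0,0\rangle,\langle0,\bullet\rangle\}^m\setminus\{\langle0,0\rangle\}^m$. Standing assumption: the subalgebra of $\mathbb{A}(\mathcal{M})$ generated by $\{\langle1,\bullet\rangle,\langle1,0\rangle\}$ contains $\langle0,\bullet\rangle$. *)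

(* Defs.v *)
From HB Require Import structures.
From Stdlib Require Import Relation_Operators.
From mathcomp Require Import all_boot.

Set Implicit Arguments.
Unset Strict Implicit.
Unset Printing Implicit Defensive.

Inductive reg := RA | RB.

Definition bool_of_reg (r : reg) : bool := if r is RA then true else false.
Definition reg_of_bool (b : bool) : reg := if b then RA else RB.
Lemma bool_of_regK : cancel bool_of_reg reg_of_bool. Proof. by case. Qed.
HB.instance Definition _ := Finite.copy reg (can_type bool_of_regK).

(* The states 0, ..., N are the elements of 'I_N.+1. *)
Notation state N := 'I_N.+1.

(* [Inc i R j] is the instruction (i,R,j); [Dec i R k j] is (i,R,k,j), where k
   is the branch taken when R is zero and j the branch taken after
   decrementing R. *)
Inductive instr (N : nat) :=
  | Inc of state N & reg & state N
  | Dec of state N & reg & state N & state N.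

Definition sum_of_instr N (I : instr N) :
    (state N * reg * state N) + (state N * reg * state N * state N) :=
  match I with
  | Inc i R j => inl (i, R, j)
  | Dec i R k j => inr (i, R, k, j)
  end.
Definition instr_of_sum N
    (s : (state N * reg * state N) + (state N * reg * state N * state N)) :
    instr N :=
  match s with
  | inl (i, R, j) => Inc i R j
  | inr (i, R, k, j) => Dec i R k j
  end.
Lemma sum_of_instrK N : cancel (@sum_of_instr N) (@instr_of_sum N).
Proof. by case. Qed.
HB.instance Definition _ N :=
  Finite.copy (instr N) (can_type (@sum_of_instrK N)).

Definition source N (I : instr N) : state N :=
  match I with Inc i _ _ => i | Dec i _ _ _ => i end.

Definition halt_state {N : nat} : state N := ord0.
(* [inord 1] is the state 1 because N > 0 is part of [is_minsky] below. *)
Definition init_state {N : nat} : state N := inord 1.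

(* A program is a finite set of instructions.  The clauses defining the action
   of a machine are compatible with M(0,a,b) = (0,a,b) only if no instruction
   starts at the halting state, and there is exactly one instruction for each
   of the other states. *)
Definition is_minsky N (M : {set instr N}) : Prop :=
  [/\ 0 < N,
      (forall I, I \in M -> source I != halt_state)
    & (forall i : state N, i != halt_state ->
         #|[set I in M | source I == i]| = 1)].

(* The unique instruction of M starting at i, when there is one. *)
Definition instr_at N (M : {set instr N}) (i : state N) : option (instr N) :=
  [pick I in M | source I == i].

Definition config (N : nat) : Type := (state N * nat * nat)%type.

Definition step N (M : {set instr N}) (c : config N) : config N :=
  let: (i, a, b) := c in
  if i == halt_state then (halt_state, a, b) else
  match instr_at M i with
  | Some (Inc _ RA j) => (j, a.+1, b)
  | Some (Inc _ RB j) => (j, a, b.+1)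
  | Some (Dec _ RA k j) => if a != 0 then (j, a.-1, b) else (k, a, b)
  | Some (Dec _ RB k j) => if b != 0 then (j, a, b.-1) else (k, a, b)
  | None => c
  end.

Definition run N (M : {set instr N}) (n : nat) : config N :=
  iter n (step M) (init_state, 0, 0).

Definition halts N (M : {set instr N}) : Prop :=
  exists n, (run M n).1.1 = halt_state.

Definition halts_with_capacity N (M : {set instr N}) (kappa : nat) : Prop :=
  halts M /\
  forall n i a b, run M n = (i, a, b) -> a + b <= kappa.

Definition state_edge N (M : {set instr N}) (i j : state N) : Prop :=
  exists a b a' b', step M (i, a, b) = (j, a', b').

Definition reachable N (M : {set instr N}) : state N -> state N -> Prop :=
  clos_refl_trans (state N) (state_edge M).

Record machine_assumptions N (M : {set instr N}) (kappa : nat) : Prop := {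
  machine_wf : is_minsky M;
  machine_registers_reset :
    forall n a b, run M n = (halt_state, a, b) -> a = 0 /\ b = 0;
  machine_first_instr : exists R s, Inc init_state R s \in M;
  machine_from_init : forall i, reachable M init_state i;
  machine_to_halt : forall i, reachable M i halt_state;
  machine_capacity : halts_with_capacity M kappa
}.

(* Dot, Cross, Zero and Reg R are the contents written •, ×, 0 and R. *)
Inductive content := Dot | Cross | Zero | Reg of reg.

Definition sum_of_content (c : content) : 'I_3 + reg :=
  match c with
  | Dot => inl (inord 0)
  | Cross => inl (inord 1)
  | Zero => inl (inord 2)
  | Reg R => inr R
  end.
Definition content_of_sum (s : 'I_3 + reg) : content :=
  match s with
  | inl i => match val i with 0 => Dot | 1 => Cross | _ => Zero end
  | inr R => Reg R
  end.
Lemma sum_of_contentK : cancel sum_of_content content_of_sum.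
Proof. by case=> //=; rewrite inordK. Qed.
HB.instance Definition _ := Finite.copy content (can_type sum_of_contentK).

Notation carrier N := ('I_N.+1 * content)%type.

Definition State N (x : carrier N) : state N := x.1.
Definition Content N (x : carrier N) : content := x.2.
Definition toX N (x : carrier N) : carrier N := (State x, Cross).

Definition Xset N : {set carrier N} := [set x | Content x == Cross].
Definition Dset N : {set carrier N} := [set x | Content x == Dot].
Definition Cset N : {set carrier N} := ~: (Xset N :|: Dset N).

Definition meet N (x y : carrier N) : carrier N :=
  if x == y then x
  else (if State x <= State y then State x else State y, Cross).

Definition opM N (M : {set instr N}) (x y : carrier N) : carrier N :=
  if State x != State y then toX y else
  let c := Content x in
  let d := Content y in
  let copy j : carrier N :=
    if (c == d) && (c != Dot) then (j, c) else (j, Cross) in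
  match instr_at M (State x) with
  | Some (Inc _ R j) =>
      if (c == Dot) && (d == Zero) then (j, Reg R)
      else if (c == Zero) && (d == Dot) then (j, Dot)
      else copy j
  | Some (Dec _ R _ j) =>
      if (c == Dot) && (d == Reg R) then (j, Zero)
      else if (c == Reg R) && (d == Dot) then (j, Dot)
      else copy j
  | None => toX y
  end.

Definition opM' N (M : {set instr N}) (x : carrier N) : carrier N :=
  match instr_at M (State x) with
  | Some (Dec _ R k _) =>
      if Content x != Reg R then (k, Content x) else (k, Cross)
  | _ => toX x
  end.

Definition opI N (x y : carrier N) : carrier N :=
  if x \in Dset N then (init_state, Dot)
  else if y \in Cset N then (init_state, Zero)
  else (init_state, Cross).

Definition opH N (x : carrier N) : carrier N :=
  if (x == (halt_state, Zero)) || (x == (halt_state, Dot))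
  then (halt_state, Zero) else (halt_state, Cross).

Definition opN0 N (x y z : carrier N) : carrier N :=
  if (x == (halt_state, Dot)) && (State y == State z) then y
  else if [&& x == (halt_state, Zero), z \notin Dset N & State y == State z]
  then z
  else toX (meet y z).

Definition opS N (x y z : carrier N) : carrier N :=
  if [&& x == (init_state, Zero), State y == init_state, State z == init_state
       & (Content y, Content z) \in [:: (Dot, Zero); (Zero, Dot); (Zero, Zero)]]
  then (init_state, Zero) else (init_state, Cross).

Definition opNdot N (u x y z : carrier N) : carrier N :=
  let e := (State x == State y) && (State y == State z) in
  if [&& e, x == y & x \notin Xset N] then x
  else if [&& e, u \in Dset N & y \in Xset N] then x
  else if [&& e, u \in Dset N & x \in Xset N] then y
  else if [&& e, u \in Dset N & z \in [:: x; y]] then z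
  else toX (meet (meet x y) z).

Definition opP N (u v x y : carrier N) : carrier N :=
  if State u == State v then x else y.

Inductive opsym := OMeet | OM | OM' | OI | OH | ON0 | OS | ONdot | OP.

Definition arity (o : opsym) : nat :=
  match o with
  | OM' | OH => 1
  | OMeet | OM | OI => 2
  | ON0 | OS => 3
  | ONdot | OP => 4
  end.

Definition operation (N n : nat) : Type := {ffun 'I_n -> carrier N} -> carrier N.

Definition interp N (M : {set instr N}) (o : opsym) : operation N (arity o) :=
  match o return operation N (arity o) with
  | OMeet => fun t => meet (t (inord 0)) (t (inord 1))
  | OM => fun t => opM M (t (inord 0)) (t (inord 1))
  | OM' => fun t => opM' M (t (inord 0))
  | OI => fun t => opI (t (inord 0)) (t (inord 1))
  | OH => fun t => opH (t (inord 0))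
  | ON0 => fun t => opN0 (t (inord 0)) (t (inord 1)) (t (inord 2))
  | OS => fun t => opS (t (inord 0)) (t (inord 1)) (t (inord 2))
  | ONdot => fun t =>
      opNdot (t (inord 0)) (t (inord 1)) (t (inord 2)) (t (inord 3))
  | OP => fun t => opP (t (inord 0)) (t (inord 1)) (t (inord 2)) (t (inord 3))
  end.

Notation relation N m := {set {ffun 'I_m -> carrier N}}.

Definition preserves N n (f : operation N n) m (R : relation N m) : Prop :=
  forall r : 'I_n -> {ffun 'I_m -> carrier N},
    (forall a, r a \in R) -> [ffun i => f [ffun a => r a i]] \in R.

Definition is_relation N (M : {set instr N}) m (R : relation N m) : Prop :=
  R != set0 /\ forall o, preserves (@interp N M o) R.

Definition in_generated_subalgebra N (M : {set instr N})
    (G : {set carrier N}) (x : carrier N) : Prop :=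
  forall B : {set carrier N}, G \subset B ->
    (forall o (t : {ffun 'I_(arity o) -> carrier N}),
       (forall a, t a \in B) -> interp M t \in B) ->
    x \in B.

Definition synchronized N m (s : {ffun 'I_m -> carrier N}) : Prop :=
  forall i j, State (s i) = State (s j).

Definition computational N m (R : relation N m) : Prop :=
  forall r, r \in R -> synchronized r /\ #|[set i | r i \in Dset N]| <= 1.

Definition halting N m (R : relation N m) : Prop :=
  exists r, [/\ r \in R,
    (forall i, r i \in [:: (halt_state, Zero); (halt_state, Dot)])
    & ~ (forall i, r i = (halt_state, Zero))].

Definition Rel_le_models N (M : {set instr N}) (k m : nat) (R : relation N m) :
    Prop :=
  forall n (f : operation N n),
    (forall l (S : relation N l), l <= k -> is_relation M S -> preserves f S) ->
    preserves f R.

(* Main.v *)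
Require Import Defs.

From mathcomp Require Import all_boot.

(** If [f] preserves all relations of arity less than [m] and [t] is a value of
    [f] on tuples of [R], then for each [k] some tuple [t_k] of [R] agrees with
    [t] off the coordinate [k].  An unsynchronized tuple makes [R] a product of
    two of its projections, by [P].  A tuple with two coordinates in [D] lets
    [N_dot] act on three of the [t_k] as a majority vote.  A halting tuple
    lets [N_0] splice two of the [t_k]; when the dot is at the wrong
    coordinate, running the generation of <0,dot> at the right coordinate,
    with content 0 elsewhere, gives a halting tuple with its dot there. *)

Set Implicit Arguments.
Unset Strict Implicit.
Unset Printing Implicit Defensive.

(** * Values of the operations on single elements *)

Section Elements.

Variable N : nat.
Implicit Types (x y z u t : carrier N) (M : {set instr N}).

Lemma contentE :
  ((Dot == Dot = true) * (Dot == Cross = false) * (Dot == Zero = false) *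
   (Cross == Dot = false) * (Cross == Cross = true) * (Cross == Zero = false) *
   (Zero == Dot = false) * (Zero == Cross = false) *
   (Zero == Zero = true))%type *
  ((forall r, Dot == Reg r = false) * (forall r, Cross == Reg r = false) *
   (forall r, Zero == Reg r = false) * (forall r, Reg r == Dot = false) *
   (forall r, Reg r == Cross = false) * (forall r, Reg r == Zero = false) *
   (forall r, Reg r == Reg r = true)).
Proof. by do !split=> *; apply/eqP. Qed.

Lemma in_Cset x : (x \in Cset N) = (x \notin Xset N) && (x \notin Dset N).
Proof. by rewrite !inE negb_or. Qed.

Lemma State_meet x y : State x = State y -> State (meet x y) = State x.
Proof. by rewrite /meet => e; case: eqP => //; rewrite e leqnn. Qed.

Lemma toX_id x : x \in Xset N -> toX x = x.
Proof. by case: x => i c; rewrite inE /= => /eqP ->. Qed.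

Lemma toX_meet3 x y z :
  State x = State y -> State y = State z -> toX (meet (meet x y) z) = toX x.
Proof. by move=> exy eyz; rewrite /toX !State_meet // ?exy // State_meet. Qed.

(** Outside [X] the first clause applies; inside [X] either the second clause or the default gives
    [x], as [toX] fixes [X]. So a wrong third vote does no harm. *)
Lemma opNdotxx u x z : State z = State x -> opNdot u x x z = x.
Proof.
move=> ez; rewrite /opNdot ez !eqxx /=.
case: ifP => // /negbFE xX; case: ifP => //; rewrite xX andbT => -> /=.
by rewrite toX_meet3 // toX_id.
Qed.

(* Where one of the first two of three votes is wrong, [N_dot] returns the
   majority value exactly when membership of its first argument in [D] tells
   whether that value lies outside [X]. *)
Lemma opNdot_majr u x t : State x = State t ->
  (u \in Dset N) = (t \notin Xset N) -> opNdot u x t t = t.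
Proof.
move=> ex ut; rewrite /opNdot ex !eqxx ut /=.
case: ifP => [/andP[/eqP-> //]|_]; case: ifP => [/andP[/negP] //|_].
case: ifP => // _; rewrite mem_seq2 !eqxx orbT andbT.
case: ifP => // /negbFE tX.
by rewrite toX_meet3 // /toX ex; exact: toX_id.
Qed.

Lemma opNdot_majl u y t : State y = State t ->
  (u \in Dset N) = (t \notin Xset N) -> opNdot u t y t = t.
Proof.
move=> ey ut; rewrite /opNdot ey !eqxx ut /=.
case: ifP => // _; case: ifP => // _; case: ifP => [/andP[/negP] //|_].
rewrite mem_seq2 eqxx andbT; case: ifP => // /negbFE tX.
by rewrite toX_meet3 // toX_id.
Qed.

Lemma State_opI x y : State (opI x y) = init_state.
Proof. by rewrite /opI; do 2 case: ifP => //. Qed.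

Lemma opI_Dset x y : x \in Dset N -> opI x y = (init_state, Dot).
Proof. by rewrite /opI => ->. Qed.

Lemma opH_notinD x : opH x \notin Dset N.
Proof. by rewrite /opH inE; case: ifP => _ /=; rewrite contentE. Qed.

Lemma opN0_first x y z :
  x = (halt_state, Dot) -> State y = State z -> opN0 x y z = y.
Proof. by move=> -> e; rewrite /opN0 eqxx e eqxx. Qed.

Lemma opN0_second x y z : x = (halt_state, Zero) ->
  State y = State z -> z \notin Dset N -> opN0 x y z = z.
Proof.
move=> -> e zD; rewrite /opN0 e !eqxx zD andbT /=.
by case: eqP.
Qed.

Lemma State_opM_diag M x I : instr_at M (State x) = Some I ->
  State (opM M x x) = match I with Inc _ _ j | Dec _ _ _ j => j end.
Proof.
move=> e; rewrite /opM eqxx e /=.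
by case: I e => *; do !case: ifP => //.
Qed.

Lemma State_opM' M x i r k j : instr_at M (State x) = Some (Dec i r k j) ->
  State (opM' M x) = k.
Proof. by rewrite /opM' => ->; case: ifP. Qed.

(** Crosses are absorbing, so a computation of an element outside [X] can be followed through
    elements outside [X] only. *)
Lemma opM_notinX M x y :
  opM M x y \notin Xset N -> x \notin Xset N /\ y \notin Xset N.
Proof.
case: x y => [i c] [j d]; rewrite /opM /=.
case: ifP => _; first by rewrite !inE eqxx.
case: (instr_at M i) => [[? r k|? r h k]|]; last by rewrite !inE eqxx.
- by case: c => [|||r1]; case: d => [|||r2]; rewrite !inE /= ?contentE //=;
    case: ifP.
- by case: c => [|||r1]; case: d => [|||r2];
    rewrite !inE /= ?contentE ?andbF //=; do ?case: ifP => //=;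
    rewrite ?contentE.
Qed.

Lemma opM'_notinX M x : opM' M x \notin Xset N -> x \notin Xset N.
Proof.
case: x => [i c]; rewrite /opM' /=.
case: (instr_at M i) => [[? r k|? r h k]|]; rewrite !inE ?eqxx //.
by case: ifP; rewrite ?eqxx.
Qed.

(** A value outside [X] forces equal states and an instruction there; that instruction copies two
    contents 0 to the same next state. *)
Lemma opM_Zero M x y : opM M x y \notin Xset N ->
  opM M (State x, Zero) (State y, Zero) = (State (opM M x y), Zero).
Proof.
rewrite /opM /=; case: ifP => [_|/negbFE/eqP e]; first by rewrite !inE eqxx.
case: (instr_at M (State x)) => [[i r j|i r k j]|]; last by rewrite !inE eqxx.
- by rewrite /= !contentE /=; do !case: ifP.
- by rewrite /= !contentE /=; do !case: ifP.
Qed.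

Lemma opM'_Zero M x : opM' M x \notin Xset N ->
  opM' M (State x, Zero) = (State (opM' M x), Zero).
Proof.
rewrite /opM' /=.
case: (instr_at M (State x)) => [[i r j|i r k j]|]; rewrite ?inE ?eqxx //.
by case: ifP.
Qed.

End Elements.

Local Notation vec N m := {ffun 'I_m -> carrier N}.

(** * Closure of a relation under each operation *)

Section Closure.

Variables (N : nat) (M : {set instr N}) (m : nat) (R : relation N m).
Hypothesis hR : is_relation M R.
Implicit Types x y z u v : vec N m.

(** With the arguments in a sequence, one statement serves all arities; the default of [nth] is
    never reached, since indices stay below [size s]. *)
Lemma rel_op (o : opsym) (s : seq (vec N m)) :
  size s = arity o -> all [in R] s ->
  [ffun i => interp M [ffun a : 'I_(arity o) => nth [ffun=> (ord0, Dot)] s a i]]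
    \in R.
Proof.
move=> es /allP sR; have [_ /(_ o) pR] := hR.
apply: (pR (fun a => nth [ffun=> (ord0, Dot)] s a)) => a.
by apply: sR; rewrite mem_nth // es.
Qed.

Lemma rel_opM x y : x \in R -> y \in R ->
  [ffun i => opM M (x i) (y i)] \in R.
Proof.
move=> xR yR; have := @rel_op OM [:: x; y] erefl.
rewrite (_ : finfun _ = [ffun i => opM M (x i) (y i)]).
  by apply; rewrite /= xR yR.
by apply/ffunP => i; rewrite !ffunE /= !ffunE /= ?inordK.
Qed.

Lemma rel_opM' x : x \in R ->
  [ffun i => opM' M (x i)] \in R.
Proof.
move=> xR; have := @rel_op OM' [:: x] erefl.
rewrite (_ : finfun _ = [ffun i => opM' M (x i)]).
  by apply; rewrite /= xR.
by apply/ffunP => i; rewrite !ffunE /= !ffunE /= ?inordK.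
Qed.

Lemma rel_opI x y : x \in R -> y \in R ->
  [ffun i => opI (x i) (y i)] \in R.
Proof.
move=> xR yR; have := @rel_op OI [:: x; y] erefl.
rewrite (_ : finfun _ = [ffun i => opI (x i) (y i)]).
  by apply; rewrite /= xR yR.
by apply/ffunP => i; rewrite !ffunE /= !ffunE /= ?inordK.
Qed.

Lemma rel_opH x : x \in R ->
  [ffun i => opH (x i)] \in R.
Proof.
move=> xR; have := @rel_op OH [:: x] erefl.
rewrite (_ : finfun _ = [ffun i => opH (x i)]).
  by apply; rewrite /= xR.
by apply/ffunP => i; rewrite !ffunE /= !ffunE /= ?inordK.
Qed.

Lemma rel_opN0 x y z : x \in R -> y \in R -> z \in R ->
  [ffun i => opN0 (x i) (y i) (z i)] \in R.
Proof.
move=> xR yR zR; have := @rel_op ON0 [:: x; y; z] erefl.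
rewrite (_ : finfun _ = [ffun i => opN0 (x i) (y i) (z i)]).
  by apply; rewrite /= xR yR zR.
by apply/ffunP => i; rewrite !ffunE /= !ffunE /= ?inordK.
Qed.

Lemma rel_opNdot u x y z : u \in R -> x \in R -> y \in R -> z \in R ->
  [ffun i => opNdot (u i) (x i) (y i) (z i)] \in R.
Proof.
move=> uR xR yR zR; have := @rel_op ONdot [:: u; x; y; z] erefl.
rewrite (_ : finfun _ = [ffun i => opNdot (u i) (x i) (y i) (z i)]).
  by apply; rewrite /= uR xR yR zR.
by apply/ffunP => i; rewrite !ffunE /= !ffunE /= ?inordK.
Qed.

Lemma rel_opP u v x y : u \in R -> v \in R -> x \in R -> y \in R ->
  [ffun i => opP (u i) (v i) (x i) (y i)] \in R.
Proof.
move=> uR vR xR yR; have := @rel_op OP [:: u; v; x; y] erefl.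
rewrite (_ : finfun _ = [ffun i => opP (u i) (v i) (x i) (y i)]).
  by apply; rewrite /= uR vR xR yR.
by apply/ffunP => i; rewrite !ffunE /= !ffunE /= ?inordK.
Qed.

End Closure.

(** * Projections to few coordinates *)

Section Projection.

Variables (N : nat) (M : {set instr N}) (m : nat) (R : relation N m).
Hypothesis hR : is_relation M R.

Definition project l (g : 'I_l -> 'I_m) : relation N l :=
  [set [ffun i => s (g i)] | s : vec N m in R].

Lemma is_relation_project l (g : 'I_l -> 'I_m) : is_relation M (project g).
Proof.
have [/set0Pn[r rR] pR] := hR; split.
  by apply/set0Pn; exists [ffun i => r (g i)]; apply: imset_f.
move=> o s sP.
have /fin_all_exists2[s' s'R s'E] : forall a, exists2 w,
    w \in R & s a = [ffun i => w (g i)] by move=> a; apply/imsetP.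
apply/imsetP; exists [ffun i => interp M [ffun a => s' a i]]; first exact: pR.
apply/ffunP => i; rewrite !ffunE; congr interp.
by apply/ffunP => a; rewrite !ffunE s'E ffunE.
Qed.

(** The projection of [R] to [K] has arity [#|K|], so [f] preserves it; [s] is a preimage of the
    value of [f] there. *)
Lemma preserves_project n (f : operation N n) k :
  (forall l (S : relation N l), l <= k -> is_relation M S -> preserves f S) ->
  forall r : 'I_n -> vec N m, (forall a, r a \in R) ->
  forall K : {set 'I_m}, #|K| <= k ->
  exists2 s : vec N m,
    s \in R & {in K, s =1 [ffun i => f [ffun a => r a i]]}.
Proof.
move=> pf r rR K leK.
pose g (i : 'I_#|K|) := enum_val i.
have := pf _ _ leK (is_relation_project g) (fun a => [ffun i => r a (g i)]).
case/(_ _)/imsetP => [a|s sR es]; first exact: imset_f.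
exists s => // i iK; move/ffunP/(_ (enum_rank_in iK i)): es.
rewrite !ffunE /g enum_rankK_in // => <-; congr f.
by apply/ffunP => a; rewrite !ffunE enum_rankK_in.
Qed.

End Projection.

(** * Following the state graph inside a relation *)

Section Machine.

Variables (N : nat) (M : {set instr N}) (kappa : nat).
Hypothesis hM : machine_assumptions M kappa.

Lemma instr_at_nonhalt (i : state N) :
  i != halt_state -> exists I, instr_at M i = Some I.
Proof.
have [_ _ inst1] := machine_wf hM; move=> /inst1 c1.
rewrite /instr_at; case: pickP => [I _|nI]; first by exists I.
by move: c1; rewrite (eq_card0 (A := [set _ in _ | _])) // => I; rewrite inE nI.
Qed.

Lemma instr_at_init :
  exists r s, instr_at M init_state = Some (Inc init_state r s).
Proof.
have [_ src inst1] := machine_wf hM.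
have [r [s rsM]] := machine_first_instr hM; exists r, s.
have /inst1/eqP/cards1P[I eI] := src _ rsM.
rewrite /instr_at; case: pickP => [J JM|/(_ (Inc init_state r s))]; last first.
  by rewrite rsM /= eqxx.
have: J \in [set I] by rewrite -eI inE.
have: Inc init_state r s \in [set I] by rewrite -eI inE rsM /= eqxx.
by rewrite !inE => /eqP-> /eqP->.
Qed.

Section Relation.

Variables (m : nat) (R : relation N m).
Hypothesis hR : is_relation M R.
Implicit Types u v t : vec N m.

(** [M] applied to [x] twice follows an increment or a decrement, [M'] follows the zero branch, and
    at the halting state [x] itself serves. *)
Lemma rel_State_step (i j : state N) (x : vec N m) : state_edge M i j ->
  x \in R -> (forall l, State (x l) = i) ->
  exists2 y : vec N m, y \in R & forall l, State (y l) = j.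
Proof.
move=> [a [b [a' [b']]]] + xR xi; rewrite /step.
case: eqP => [ei [ej _ _]|/eqP/instr_at_nonhalt[I eI]].
  by exists x => // l; rewrite xi ei ej.
have diag : exists2 y : vec N m, y \in R & forall l, State (y l) =
    match I with Inc _ _ j0 | Dec _ _ _ j0 => j0 end.
  exists [ffun l => opM M (x l) (x l)]; first exact: (rel_opM hR).
  by move=> l; rewrite ffunE (@State_opM_diag _ _ _ I) // xi.
rewrite eI; case: I eI diag => [i0 [] j0|i0 r k0 j0] eI diag.
- by case=> <-.
- by case=> <-.
have zero : exists2 y : vec N m, y \in R & forall l, State (y l) = k0.
  exists [ffun l => opM' M (x l)]; first exact: (rel_opM' hR).
  by move=> l; rewrite ffunE (@State_opM' _ _ _ i0 r k0 j0) // xi.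
by case: r {eI diag} zero (diag) => zero diag; case: ifP => _ [<-].
Qed.

(** [I] sends any tuple to the initial state, from which every state is reachable. *)
Lemma rel_State (i : state N) :
  exists2 x : vec N m, x \in R & forall l, State (x l) = i.
Proof.
have [/set0Pn[r rR] _] := hR.
have [x xR xi] :
    exists2 x : vec N m, x \in R & forall l, State (x l) = init_state.
  exists [ffun l => opI (r l) (r l)]; first exact: (rel_opI hR).
  by move=> l; rewrite ffunE State_opI.
elim: (machine_from_init hM i) x xR xi => {i}
    [i j e x xR xi | i x xR xi | i j k _ IH1 _ IH2 x xR xi].
- exact: rel_State_step e xR xi.
- by exists x.
- by have [y yR yj] := IH1 x xR xi; apply: IH2 yR yj.
Qed.

(* Comparing an unsynchronized tuple with one in a constant state, [P] makes
   [R] the product of its projections on two complementary sets. *)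
Lemma unsynchronized_mem (r : vec N m) p q t :
  r \in R -> State (r p) != State (r q) ->
  (forall K : {set 'I_m}, #|K| < m ->
     exists2 s : vec N m, s \in R & {in K, s =1 t}) ->
  t \in R.
Proof.
move=> rR rpq agree.
have [v vR vE] := rel_State (State (r p)).
pose K := [set i | State (r i) == State (r p)].
have ltK (A : {set 'I_m}) a : a \notin A -> #|A| < m.
  move=> aA; rewrite -[X in _ < X]card_ord -cardsT; apply: proper_card.
  by apply/properP; split; [exact: subsetT | exists a].
(* [K] omits [q] and its complement omits [p], so both have fewer than [m] elements. *)
have [s1 s1R s1E] : exists2 s, s \in R & {in K, s =1 t}.
  by apply: agree; apply: (ltK _ q); rewrite inE eq_sym.
have [s2 s2R s2E] : exists2 s, s \in R & {in ~: K, s =1 t}.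
  by apply: agree; apply: (ltK _ p); rewrite !inE eqxx.
rewrite (_ : t = [ffun i => opP (r i) (v i) (s1 i) (s2 i)]).
  exact: (rel_opP hR).
apply/ffunP => i; rewrite ffunE /opP vE; case: ifP => e.
  by rewrite s1E // inE e.
by rewrite s2E // !inE e.
Qed.

(** * Majority votes among tuples that agree with [t] off one coordinate *)

Hypothesis m3 : 3 <= m.

Lemma ord_avoid2 (p q : 'I_m) : exists2 k, k != p & k != q.
Proof.
have: 0 < #|~: [set p; q]|.
  have := cardsC [set p; q]; rewrite card_ord cards2 => e.
  rewrite lt0n; apply/eqP => c0; move: e m3; rewrite c0 addn0 => <-.
  by case: (p == q).
case/card_gt0P=> k; rewrite !inE negb_or => /andP[kp kq].
by exists k.
Qed.

Hypothesis syncR : forall r : vec N m, r \in R -> synchronized r.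

Variable t : vec N m.
Hypothesis near : forall k,
  exists2 s : vec N m, s \in R & forall i, i != k -> s i = t i.

(** This covers [i = k] too: [s] is synchronized, and so is [t], because any two of its coordinates
    occur together in a tuple of [R] altered at a third. *)
Lemma State_near (s : vec N m) k i :
  s \in R -> (forall i, i != k -> s i = t i) ->
  State (s i) = State (t i).
Proof.
move=> sR sE; have [l lk li] := ord_avoid2 k i.
rewrite (syncR sR i l) sE //.
have [k' k'l k'i] := ord_avoid2 l i.
have [s' s'R s'E] := near k'.
by rewrite -[t l]s'E 1?eq_sym // -[t i]s'E 1?eq_sym //; apply: syncR.
Qed.

(** The three voters err at distinct coordinates [p], [q], [l], so each coordinate has two correct
    votes; only at [p] and [q] does the first argument [v] matter. *)
Lemma opNdot_mem v p q : p != q -> v \in R ->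
  (v p \in Dset N) = (t p \notin Xset N) ->
  (v q \in Dset N) = (t q \notin Xset N) -> t \in R.
Proof.
move=> pq vR vp vq; have [l lp lq] := ord_avoid2 p q.
have [x xR xE] := near p; have [y yR yE] := near q; have [z zR zE] := near l.
rewrite (_ : t = [ffun i => opNdot (v i) (x i) (y i) (z i)]).
  exact: (rel_opNdot hR).
apply/ffunP => i; rewrite ffunE.
have [->|ip] := eqVneq i p.
  by rewrite yE // zE 1?eq_sym // opNdot_majr // (State_near p xR xE).
rewrite xE //; have [->|iq] := eqVneq i q.
  by rewrite zE 1?eq_sym // opNdot_majl // (State_near q yR yE).
by rewrite yE // opNdotxx // (State_near i zR zE).
Qed.

Lemma two_dots_mem_mixed u i j : i != j -> u \in R ->
  u i \in Dset N -> u j \in Dset N ->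
  t i \in Xset N -> t j \notin Xset N -> t \in R.
Proof.
move=> ij uR ui uj ti tj; have [k ki kj] := ord_avoid2 i j.
have [s sR sE] := near k.
have si : s i = t i by rewrite sE // eq_sym.
have sj : s j = t j by rewrite sE // eq_sym.
have [tjD|tjD] := boolP (t j \in Dset N).
  apply: (@opNdot_mem s i j) => //; last by rewrite sj tjD tj.
  by rewrite si ti; move: ti; rewrite !inE => /eqP->; rewrite contentE.
(* The first argument needs a dot at [j] and none at [i]. State 1 carries an increment, so [M] takes
   0 and a dot to a dot at [j], but a cross and a dot to a cross at [i]. *)
pose a := [ffun l => opI (u l) (u l)]; pose c := [ffun l => opI (s l) (s l)].
have ca : [ffun l => opM M (c l) (a l)] \in R.
  by apply: (rel_opM hR); apply: (rel_opI hR).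
have [r [h e]] := instr_at_init.
have tiE : Content (t i) = Cross by move: ti; rewrite inE => /eqP.
have ci : c i = (init_state, Cross).
  by rewrite ffunE si /opI !inE !tiE !contentE.
have cj : c j = (init_state, Zero).
  by rewrite ffunE sj /opI (negPf tjD) in_Cset tjD tj.
apply: (opNdot_mem ij ca).
  by rewrite ti ffunE ci ffunE opI_Dset // /opM eqxx /= e inE /= !contentE.
by rewrite tj ffunE cj ffunE opI_Dset // /opM eqxx /= e inE /= !contentE.
Qed.

(** The first argument of the vote depends on where [t] has crosses: [u] if at neither [i] nor [j],
    its image under [H], which has no dots, if at both. *)
Lemma two_dots_mem u i j : i != j -> u \in R ->
  u i \in Dset N -> u j \in Dset N -> t \in R.
Proof.
move=> ij uR ui uj.
have [ti|ti] := boolP (t i \in Xset N); have [tj|tj] := boolP (t j \in Xset N).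
- apply: (opNdot_mem ij (rel_opH hR uR)); rewrite ffunE ?ti ?tj;
    exact/negbTE/opH_notinD.
- exact: (@two_dots_mem_mixed u i j).
- by apply: (@two_dots_mem_mixed u j i) => //; rewrite eq_sym.
- by apply: (opNdot_mem ij uR); rewrite ?ui ?uj ?ti ?tj.
Qed.

(** * Halting tuples with the dot at a prescribed coordinate *)

Definition spike p (x : carrier N) : vec N m :=
  [ffun i => if i == p then x else (State x, Zero)].

(* The set [B] of all [x] that lie in [X] or have [spike p x] in [R] is a
   subuniverse, because the content 0 is carried along with the values
   outside [X]. *)
Lemma spike_generated p (x : carrier N) :
  in_generated_subalgebra M [set (init_state, Dot); (init_state, Zero)] x ->
  x \notin Xset N ->
  spike p (init_state, Dot) \in R -> spike p (init_state, Zero) \in R ->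
  spike p (halt_state, Zero) \in R ->
  spike p x \in R.
Proof.
move=> gen xX dotR zeroR haltR.
pose B := [set y | (y \notin Xset N) ==> (spike p y \in R)].
suff: x \in B by rewrite inE xX.
have XB y : Content y = Cross -> y \in B by move=> e; rewrite !inE e eqxx.
have toXB y : toX y \in B by apply: XB.
have CB i : (i, Cross) \in B by apply: XB.
apply: gen => [|o s sB].
  by apply/subsetP => y; rewrite !inE => /orP[] /eqP ->; apply/implyP.
have spB y : y \in B -> y \notin Xset N -> spike p y \in R.
  by rewrite inE => /implyP.
(* Apart from [M] and [M'], every operation returns one of these three values, one of its arguments,
   or an element of [X]. *)
have dB : (init_state, Dot) \in B by rewrite inE dotR implybT.
have zB : (init_state, Zero) \in B by rewrite inE zeroR implybT.
have hB : (halt_state, Zero) \in B by rewrite inE haltR implybT.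
case: o s sB => /= s sB.
- by rewrite /meet; case: ifP.
- set y := s (inord 0); set z := s (inord 1).
  rewrite inE; apply/implyP => MX.
  have [yX zX] := opM_notinX MX.
  rewrite (_ : spike p _ = [ffun i => opM M (spike p y i) (spike p z i)]).
    by apply: (rel_opM hR) => //; apply: spB => //; apply: sB.
  apply/ffunP => i; rewrite !ffunE; case: ifP => // _.
  by rewrite opM_Zero.
- set y := s (inord 0); rewrite inE; apply/implyP => MX.
  have yX := opM'_notinX MX.
  rewrite (_ : spike p _ = [ffun i => opM' M (spike p y i)]).
    by apply: (rel_opM' hR) => //; apply: spB => //; apply: sB.
  apply/ffunP => i; rewrite !ffunE; case: ifP => // _.
  by rewrite opM'_Zero.
- by rewrite /opI; do 2 case: ifP => //.
- by rewrite /opH; case: ifP.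
- by rewrite /opN0; do 2 case: ifP => //.
- by rewrite /opS; case: ifP.
- by rewrite /opNdot; do 4 case: ifP => //.
- by rewrite /opP; case: ifP.
Qed.

(** [N_0] reads [y], wrong only at [q], at the coordinate [p], and [z], wrong only at [p],
    elsewhere; the second reading requires values outside [D]. *)
Lemma opN0_mem v p : v \in R -> v p = (halt_state, Dot) ->
  (forall i, i != p -> v i = (halt_state, Zero)) ->
  (forall i, i != p -> t i \notin Dset N) -> t \in R.
Proof.
move=> vR vp v0 tD; have [q qp _] := ord_avoid2 p p.
have [y yR yE] := near q; have [z zR zE] := near p.
rewrite (_ : t = [ffun i => opN0 (v i) (y i) (z i)]).
  exact: (rel_opN0 hR).
apply/ffunP => i; rewrite ffunE.
have eyz : State (y i) = State (z i).
  by rewrite (State_near i yR yE) (State_near i zR zE).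
have [ip|ip] := eqVneq i p.
  by rewrite opN0_first // ip // yE // eq_sym.
by rewrite opN0_second ?v0 // zE // tD.
Qed.

Lemma halting_mem :
  in_generated_subalgebra M [set (init_state, Dot); (init_state, Zero)]
    (halt_state, Dot) ->
  (forall s : vec N m, s \in R ->
     forall i j, s i \in Dset N -> s j \in Dset N -> i = j) ->
  halting R -> t \in R.
Proof.
move=> gen dot1 [r [rR rE rN0]].
have [p0 rp0] : exists p0, r p0 != (halt_state, Zero).
  apply/existsP; apply: contra_notT rN0; rewrite negb_exists => /forallP r0 i.
  by apply/eqP; have := r0 i; rewrite negbK.
have {rp0} rp0 : r p0 = (halt_state, Dot).
  by have := rE p0; rewrite !inE (negPf rp0) => /eqP.
have [nD|[p pp0 tp]] : (forall i, i != p0 -> t i \notin Dset N) \/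
    exists2 p, p != p0 & t p \in Dset N.
- case: (pickP [pred i | (i != p0) && (t i \in Dset N)]) => [p /andP[]|none].
    by right; exists p.
  by left=> i ip0; have := none i; rewrite /= ip0 => /negbT.
- apply: (opN0_mem rR rp0) => // i ip0; have := rE i.
  rewrite !inE => /orP[/eqP-> // | /eqP ri].
  by case/eqP: ip0; apply: (dot1 r) => //; rewrite ?ri ?rp0 inE.
(* Two dots of [t] would both appear in a tuple of [R] altered at a third coordinate. *)
have tD i : i != p -> t i \notin Dset N.
  move=> ip; have [k kp ki] := ord_avoid2 p i; have [s sR sE] := near k.
  apply: contraNN ip => ti; apply/eqP.
  by apply: (dot1 s) => //; rewrite sE // eq_sym.
pose h := [ffun i => opH (r i)].
have hR' : h \in R by apply: (rel_opH hR).
have hE i : h i = (halt_state, Zero) by rewrite ffunE /opH -mem_seq2 rE.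
have zC : (halt_state, Zero) \in Cset N by rewrite in_Cset !inE /= !contentE.
have zD : (halt_state, Zero) \notin Dset N by rewrite inE /= contentE.
apply: (@opN0_mem (spike p (halt_state, Dot)) p) => //; last first.
- by move=> i /negPf ip; rewrite ffunE ip.
- by rewrite ffunE eqxx.
have [k kp _] := ord_avoid2 p p; have [s sR sE] := near k.
have sp : s p \in Dset N by rewrite sE // eq_sym.
apply: spike_generated => //; first by rewrite inE /= contentE.
(* The only dot of [s] is at [p]; elsewhere [h], constantly ⟨0,0⟩, makes [I] return content 0. *)
- rewrite (_ : spike _ _ = [ffun i => opI (s i) (h i)]).
    exact: (rel_opI hR).
  apply/ffunP => i; rewrite [LHS]ffunE [RHS]ffunE; case: eqP => [->|/eqP ip].
    by rewrite opI_Dset.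
  rewrite /opI; case: ifP => [si|_]; last by rewrite hE zC.
  by case/eqP: ip; apply: (dot1 s).
- rewrite (_ : spike _ _ = [ffun i => opI (h i) (h i)]).
    exact: (rel_opI hR).
  apply/ffunP => i; rewrite [RHS]ffunE hE /opI (negPf zD) zC ffunE.
  by case: ifP.
- rewrite (_ : spike _ _ = h) //.
  by apply/ffunP => i; rewrite hE ffunE; case: ifP.
Qed.

End Relation.
End Machine.

(** * The case distinction on [R] *)

Theorem theorem8p3 (N : nat) (M : {set instr N}) (kappa : nat)
  (hM : machine_assumptions M kappa)
  (hgen : in_generated_subalgebra M
            [set (init_state, Dot); (init_state, Zero)] (halt_state, Dot))
  (m : nat) (hm : 3 <= m) (R : relation N m) (hR : is_relation M R)
  (hcase : ~ computational R \/ halting R) :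
  Rel_le_models M m.-1 R.
Proof.
move=> n f pf r rR; set t := finfun _.
have agree (K : {set 'I_m}) : #|K| < m ->
    exists2 s : vec N m, s \in R & {in K, s =1 t}.
  move=> ltK; apply: (preserves_project hR pf rR).
  by rewrite -ltnS prednK // (leq_trans _ hm).
have [syncR|] := boolP [forall s in R, forall i, forall j,
    State (s i) == State (s j)]; last first.
  case/forall_inPn=> s sR /forallPn[i /forallPn[j sij]].
  exact: (unsynchronized_mem hM hR sR sij agree).
have {}syncR (s : vec N m) : s \in R -> synchronized s.
  move=> sR i j.
  by have /forall_inP/(_ s sR)/forallP/(_ i)/forallP/(_ j)/eqP := syncR.
have near k : exists2 s : vec N m,
    s \in R & forall i, i != k -> s i = t i.
  have [|s sR sE] := agree (~: [set k]).
    by rewrite -[X in _ < X]card_ord -(cardsC [set k]) cards1.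
  by exists s => // i ik; apply: sE; rewrite !inE.
have [/exists_inP[u uR]|] := boolP [exists u in R,
    1 < #|[set i : 'I_m | u i \in Dset N]|].
  case/card_gt1P=> i [j []]; rewrite !(inE, in_set) => ui uj ij.
  by apply: (two_dots_mem hM hR hm syncR near ij uR); rewrite inE.
rewrite negb_exists_in => /forall_inP dots.
have {}dots (s : vec N m) :
    s \in R -> #|[set i | s i \in Dset N]| <= 1.
  by move=> /dots; rewrite -leqNgt.
(* By now [R] is computational, so only the halting case is left. *)
case: hcase => [[] s sR|hlt]; first by split; [apply: syncR | apply: dots].
apply: (halting_mem hR hm syncR near hgen) => // s sR i j si sj.
by have /card_le1_eqP := dots s sR; apply; rewrite inE.
Qed.
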